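(* For every integer $t\ge 2$, every finite graph $G$ with no $K_t$-minor can be represented as the intersection of at most $\tfrac{15}{2}t^2$ circular-arc graphs on $V(G)$.
   Context: Graphs are finite and simple. A circular-arc graph is the intersection graph of a family of arcs of a circle. The intersection of graphs $G_1,\dots,G_k$ on a common vertex set $V$ is the graph on $V$ whose edge set is the intersection of their edge sets. *)

(* Defs.v *)
From mathcomp Require Import all_boot all_order all_algebra.
From mathcomp Require Import boolp classical_sets set_interval reals trigo.

Set Implicit Arguments.
Unset Strict Implicit.
Unset Printing Implicit Defensive.

Import Order.TTheory GRing.Theory Num.Theory.

Local Open Scope ring_scope.

Record graph (V : finType) := Graph {
  edge :> rel V;
  edge_sym : symmetric edge;
  edge_irr : irreflexive edge }.

Definition complete_rel (V : finType) : rel V := fun x y => x != y.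

Lemma complete_sym (V : finType) : symmetric (@complete_rel V).
Proof. by move=> x y; rewrite /complete_rel eq_sym. Qed.

Lemma complete_irr (V : finType) : irreflexive (@complete_rel V).
Proof. by move=> x; rewrite /complete_rel eqxx. Qed.

Definition complete_graph (n : nat) : graph 'I_n :=
  Graph (@complete_sym 'I_n) (@complete_irr 'I_n).

Definition connected_in (V : finType) (G : graph V) (B : {set V}) : Prop :=
  B != finset.set0 /\
  forall x y, x \in B -> y \in B ->
    connect [rel u v | [&& u \in B, v \in B & G u v]] x y.

(* [phi u] is the branch set that is contracted to the vertex [u] of [H]. *)
Definition minor (W V : finType) (H : graph W) (G : graph V) : Prop :=
  exists phi : W -> {set V},
    [/\ forall u, connected_in G (phi u),
        forall u v, u != v -> [disjoint phi u & phi v]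
      & forall u v, H u v ->
          exists x y, [/\ x \in phi u, y \in phi v & G x y]].

Local Open Scope classical_set_scope.

Definition circle_point (R : realType) (theta : R) : R * R :=
  (cos theta, sin theta).

(* Arcs are closed, have distinct endpoints and are not the whole circle; in
   particular they are nonempty. For finite families, open arcs, or also
   allowing single points and the whole circle, give the same intersection
   graphs; allowing the empty set would not. *)
Definition circular_arc (R : realType) (A : set (R * R)) : Prop :=
  exists a b : R, [/\ a < b, b < a + 2 * pi
    & A = @circle_point R @` [set theta | a <= theta <= b]].

Definition circular_arc_graph (R : realType) (V : finType) (G : graph V) :
    Prop :=
  exists A : V -> set (R * R),
    (forall v, circular_arc (A v)) /\
    forall x y, G x y <-> x != y /\ A x `&` A y !=set0.

Definition is_intersection (V : finType) (k : nat) (G : graph V)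
    (H : 'I_k -> graph V) : Prop :=
  forall x y, G x y <-> forall i, H i x y.

(* Main.v *)
(* Remove vertices from G in successive connected parts. Each part lies in a
   component C of the graph induced by the unprocessed vertices, and consists of
   at most t - 1 shortest paths of C from a common root, one of them to a
   neighbour of each earlier part adjacent to C. These earlier parts are thus
   pairwise adjacent and form a clique minor together with C, so there are at
   most t - 2 of them, and each part can receive one of t - 1 slots, distinct
   from those of the earlier parts adjacent to C. Colour a vertex by its slot,
   by a path containing it, and by its distance to the root modulo 3. Two
   neighbours of a vertex of C are at distance at most 2 in C, hence they have
   distinct colours if they lie on the same shortest path. Therefore this proper
   colouring with 3 (t - 1)^2 colours is such that every vertex has at most one
   earlier neighbour in each colour class. For each colour class, two
   circular-arc supergraphs of G then suffice to separate every vertex of the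
   class from all its later non-neighbours: place the class on the circle in
   order, and extend the arc of each other vertex v from its position to a point
   at infinity, and further to its only earlier neighbour in the class, on either
   side. This yields 6 (t - 1)^2 circular-arc graphs. *)
Require Import Defs.
From mathcomp Require Import all_boot all_order all_algebra.
From mathcomp Require Import zify lra.
From mathcomp Require Import boolp classical_sets set_interval reals trigo.

Import Order.TTheory GRing.Theory Num.Theory.

Local Open Scope ring_scope.

(** * Connectivity and shortest paths in induced subgraphs *)

Section Connectivity.
Context {V : finType} (G : graph V).
Implicit Types (B C : {set V}) (r x y z : V).

Definition induced B : rel V := [rel u v | [&& u \in B, v \in B & G u v]].

Lemma induced_connect_sym B : connect_sym (induced B).
Proof.
apply: sym_connect_sym => x y; rewrite /induced /= edge_sym.
by rewrite andbCA.
Qed.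

Lemma connect_inducedS B C x y :
  B \subset C -> connect (induced B) x y -> connect (induced C) x y.
Proof.
move=> /fintype.subsetP BC; apply: connect_sub => u v /and3P[uB vB uv].
by apply: connect1; rewrite /induced /= !BC.
Qed.

Lemma connected_in_root B r : r \in B ->
  (forall x, x \in B -> connect (induced B) x r) -> connected_in G B.
Proof.
move=> rB h; split; first by apply/finset.set0Pn; exists r.
move=> x y xB yB; apply: connect_trans (h _ xB) _.
by rewrite induced_connect_sym; exact: h.
Qed.

Lemma connect_induced_mem B x y : connect (induced B) x y -> x \in B -> y \in B.
Proof.
case/connectP=> p; elim: p x => [|z p IH] x /=; first by move=> _ ->.
by case/andP=> /and3P[_ zB _] pz yl _; apply: IH pz yl zB.
Qed.

(** A walk in [B] that starts in the component of [r] never leaves it, so it can be followed to [r]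
    inside the component. *)
Lemma component_connected B r :
  r \in B -> connected_in G [set y | connect (induced B) r y].
Proof.
move=> rB; apply: (@connected_in_root _ r); first by rewrite inE connect0.
move=> x; rewrite inE induced_connect_sym => xr.
have : connect (induced B) r x by rewrite induced_connect_sym.
case/connectP: xr => p; elim: p x => [|z p IH] x /=.
  by move=> _ -> _; exact: connect0.
case/andP=> xz pz rl rx.
have rz : connect (induced B) r z by apply: connect_trans rx (connect1 xz).
apply: connect_trans (IH z pz rl rz); apply: connect1.
by rewrite /induced /= !inE rx rz; case/and3P: xz.
Qed.

(** [l] is the distance to [r] in the subgraph induced by [C]. *)
Lemma bfs_levels C r : connected_in G C -> r \in C ->
  exists l : V -> nat,
    [/\ forall x y, x \in C -> y \in C -> G x y -> (l x <= (l y).+1)%N,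
        forall x, x \in C -> l x = 0%N -> x = r
      & forall x n, x \in C -> l x = n.+1 ->
          exists y, [/\ y \in C, G x y & l y = n]].
Proof.
move=> [_ Cc] rC.
pose pr x n := [exists p : n.-tuple V, path (induced C) r p && (last r p == x)].
have prP x p : path (induced C) r p -> last r p = x -> pr x (size p).
  move=> pp pl; apply/existsP; exists (in_tuple p).
  by rewrite /= pp pl eqxx.
have ex x : exists n, (x \in C) ==> pr x n.
  case: (boolP (x \in C)) => [xC|_]; last by exists 0%N.
  by case/connectP: (Cc _ _ rC xC) => p pp pl; exists (size p); exact: prP.
pose l x := ex_minn (ex x).
have lP x : x \in C -> exists p, [/\ path (induced C) r p, last r p = x & size p = l x].
  move=> xC; rewrite /l; case: ex_minnP => n; rewrite xC /=.
  by case/existsP=> p /andP[pp /eqP pl] _; exists p; rewrite size_tuple.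
have lmin x p : path (induced C) r p -> last r p = x -> (l x <= size p)%N.
  move=> pp pl; rewrite /l; case: ex_minnP => n _; apply.
  by apply/implyP => _; exact: prP.
exists l; split.
- move=> x y xC yC xy; have [p [pp pl <-]] := lP y yC.
  rewrite -(size_rcons p x); apply: lmin; last by rewrite last_rcons.
  by rewrite rcons_path pp pl /induced /= xC yC edge_sym.
- by move=> x /lP[p [_ <- <-]] /size0nil ->.
- move=> x n xC ln; have [p [pp pl ps]] := lP x xC.
  case/lastP: p pp pl ps => [|p z]; first by rewrite ln.
  rewrite last_rcons size_rcons ln rcons_path => /andP[pp /and3P[yC _ yx]] zx [ps].
  subst z; exists (last r p); split => //; first by rewrite edge_sym.
  have ly := lmin (last r p) p pp erefl.
  apply/eqP; rewrite eqn_leq -{1}ps ly /= -ltnS -ln.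
  have [q [qq ql <-]] := lP _ yC.
  rewrite -(size_rcons q x); apply: lmin; last by rewrite last_rcons.
  by rewrite rcons_path qq ql /induced /= xC yC.
Qed.

(** [P x] is the vertex set of a shortest path from [r] to [x]; injectivity of [l] records that it
    meets each distance level at most once. *)
Lemma bfs_paths C r : connected_in G C -> r \in C ->
  exists (l : V -> nat) (P : V -> {set V}),
    (forall x y, x \in C -> y \in C -> G x y -> (l x <= (l y).+1)%N) /\
    forall x, x \in C ->
      [/\ x \in P x, r \in P x, P x \subset C, connected_in G (P x)
        & {in P x &, injective l}].
Proof.
move=> Cc rC; have [l [lip l0 lS]] := bfs_levels _ _ Cc rC.
have [x|P hP] := @choice V {set V} (fun x P => x \in C ->
      [/\ x \in P, r \in P, P \subset C, connected_in G P
        & {in P &, injective l}]); last by exists l, P.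
(* The bound by [n] ensures in the induction step that the added vertex is alone on its level. *)
suff H n : x \in C -> l x = n -> exists P : {set V},
    [/\ x \in P, r \in P, P \subset C, connected_in G P & {in P &, injective l}]
    /\ forall z, z \in P -> (l z <= n)%N.
  case: (boolP (x \in C)) => [xC|_]; last by exists [set x]%SET.
  by have [P [hP _]] := H _ xC erefl; exists P.
elim: n x => [|n IH] x xC lx.
  have -> := l0 _ xC lx; exists [set r]%SET; split; last first.
    by move=> z /set1P->; rewrite -lx (l0 _ xC lx).
  split; rewrite ?set11 ?finset.sub1set //; last by move=> ? ? /set1P-> /set1P->.
  apply: (@connected_in_root _ r); first exact: set11.
  by move=> z /set1P->.
have [y [yC xy ly]] := lS _ _ xC lx.
have [P [[yP rP PC Pc Pi] Pl]] := IH y yC ly.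
exists (x |: P)%SET; split; last first.
  by move=> z /setU1P[->|/Pl/leqW//]; rewrite lx.
split; rewrite ?finset.setU11 ?finset.setU1r //.
- by rewrite finset.subUset finset.sub1set xC.
- apply: (@connected_in_root _ r); first exact: finset.setU1r.
  have yr z : z \in P -> connect (induced (x |: P)%SET) z r.
    by move=> zP; apply: connect_inducedS (Pc.2 _ _ zP rP); apply: finset.subsetUr.
  move=> z /setU1P[->|/yr//]; apply: connect_trans (yr _ yP).
  by apply: connect1; rewrite /induced /= finset.setU11 finset.setU1r.
- have ne z : z \in P -> l x = l z -> False.
    by move=> /Pl; rewrite lx => + e; rewrite -e ltnn.
  move=> a b /setU1P[->|aP] /setU1P[->|bP] // e.
  + by case: (ne b).
  + by case: (ne a).
  + exact: Pi.
Qed.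

End Connectivity.

(** * Elimination of the vertices in connected parts, and the colouring *)

Section Layering.
Context {V : finType} (G : graph V) (m : nat).
Hypothesis minor_free : ~ minor (complete_graph m.+2) G.

(* A stage of the elimination: the vertices [x] with [tau x < n] are processed,
   and [tau x] is the index of the part containing [x]. The colour of [x] is
   [(sl (tau x), g x)]: the slot of its part, the geodesic of the part that
   contains [x], and the distance from the root modulo 3. *)
Record layering (n : nat) (tau : V -> nat) (sl : nat -> 'I_m.+1)
    (g : V -> 'I_m.+1 * 'I_3) : Prop := Layering {
  layer_connected : forall k, (k < n)%N -> connected_in G [set x | tau x == k]%SET;
  layer_attached : forall x y u v,
    (n <= tau x)%N -> connect (induced G [set z | (n <= tau z)%N]%SET) x y ->
    (tau u < n)%N -> (tau v < n)%N -> G x u -> G y v -> tau u != tau v ->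
    sl (tau u) != sl (tau v) /\
    exists u' v', [/\ tau u' = tau u, tau v' = tau v & G u' v'];
  layer_proper : forall u v, (tau u < n)%N -> (tau v < n)%N -> G u v ->
    (sl (tau u), g u) != (sl (tau v), g v);
  layer_back : forall u v w, (tau u < n)%N -> (tau v < n)%N ->
    (tau u <= tau w)%N -> (tau v <= tau w)%N -> G u w -> G v w ->
    (sl (tau u), g u) = (sl (tau v), g v) -> u = v }.

(** By [layer_attached], [m.+1] parts attached to [C] would be pairwise adjacent, and with [C] as
    last branch set they would form a complete minor. *)
Lemma few_attached {n tau sl g} (L : layering n tau sl g) (C : {set V})
    (A : seq nat) :
  connected_in G C -> (forall x, x \in C -> (n <= tau x)%N) ->
  {in C &, forall x y, connect (induced G [set z | (n <= tau z)%N]%SET) x y} ->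
  uniq A ->
  (forall k, k \in A -> (k < n)%N /\ exists x u, [/\ x \in C, tau u = k & G x u]) ->
  (size A <= m)%N.
Proof.
move=> Cc Cn CC uA hA; rewrite leqNgt; apply/negP => mA; apply: minor_free.
pose a (i : 'I_m.+2) := nth 0%N A i.
have aA (i : 'I_m.+2) : (i < m.+1)%N -> a i \in A.
  by move=> im; apply: mem_nth; apply: leq_trans mA.
pose phi (i : 'I_m.+2) :=
  if (i < m.+1)%N then [set x | tau x == a i]%SET else C.
have last_eq (i j : 'I_m.+2) : ~~ (i < m.+1)%N -> ~~ (j < m.+1)%N -> i = j.
  rewrite -!leqNgt => hi hj; apply/val_inj => /=.
  by apply/eqP; rewrite eqn_leq (leq_trans _ hj) ?(leq_trans _ hi) // -ltnS.
have a_neq (i j : 'I_m.+2) : (i < m.+1)%N -> (j < m.+1)%N -> i != j -> a i != a j.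
  by move=> hi hj; rewrite /a nth_uniq // ?(leq_trans hi) ?(leq_trans hj).
exists phi; split.
- move=> i; rewrite /phi; case: ifP => // im.
  by apply: (layer_connected _ _ _ _ L); case: (hA _ (aA i im)).
- move=> i j ij; apply/pred0P => x /=; apply/negP => /andP[].
  rewrite /phi; case: ifPn => im; case: ifPn => jm; rewrite ?inE.
  + by move=> /eqP e /eqP e'; move: (a_neq _ _ im jm ij); rewrite -e -e' eqxx.
  + by move=> /eqP e /Cn; rewrite e leqNgt (hA _ (aA i im)).1.
  + by move=> /Cn + /eqP e; rewrite e leqNgt (hA _ (aA j jm)).1.
  + by move: ij; rewrite (last_eq i j) ?eqxx.
- move=> i j; rewrite /= /complete_rel => ij.
  rewrite /phi; case: ifPn => im; case: ifPn => jm.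
  + have [ni [x [u [xC ux xu]]]] := hA _ (aA i im).
    have [nj [y [v [yC vy yv]]]] := hA _ (aA j jm).
    have [|||_ [u' [v' [e1 e2 e3]]]] :=
      layer_attached _ _ _ _ L x y u v (Cn _ xC) (CC _ _ xC yC) _ _ xu yv.
    * by rewrite ux.
    * by rewrite vy.
    * by rewrite ux vy; exact: a_neq.
    by exists u', v'; rewrite !inE e1 e2 ux vy.
  + have [ni [x [u [xC ux xu]]]] := hA _ (aA i im).
    by exists u, x; rewrite !inE ux eqxx edge_sym.
  + have [nj [x [u [xC ux xu]]]] := hA _ (aA j jm).
    by exists x, u; rewrite !inE ux eqxx.
  + by move: ij; rewrite (last_eq i j) ?eqxx.
Qed.

(** The new part [H] is a union of shortest paths in a component [C]. Conflicts with older parts are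
    excluded by the fresh slot [s], those inside [H] by the path and the distance modulo 3. *)
Lemma layering_step n tau sl g x0 : layering n tau sl g -> (n <= tau x0)%N ->
  exists tau' sl' g', layering n.+1 tau' sl' g' /\
    (#|[set x | (n < tau' x)%N]%SET| < #|[set x | (n <= tau x)%N]%SET|)%N.
Proof.
move=> L nx0; set U := [set x | (n <= tau x)%N]%SET.
have x0U : x0 \in U by rewrite inE.
pose C := [set y | connect (induced G U) x0 y]%SET.
have Cc : connected_in G C by exact: component_connected.
have x0C : x0 \in C by rewrite inE connect0.
have CU x : x \in C -> x \in U.
  by rewrite inE => h; exact: connect_induced_mem h x0U.
have Cn x : x \in C -> (n <= tau x)%N by move/CU; rewrite inE.
have CC : {in C &, forall x y, connect (induced G U) x y}.
  move=> x y; rewrite !inE => h; apply: connect_trans.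
  by rewrite induced_connect_sym.
have Cstep x y : x \in C -> (n <= tau y)%N -> G x y -> y \in C.
  move=> xC yn xy; have xU := CU _ xC; move: xC; rewrite !inE => h.
  apply: connect_trans h (connect1 _).
  by rewrite /induced /= xU inE yn.
have Cconn x y : x \in C -> connect (induced G U) x y -> y \in C.
  by rewrite !inE; exact: connect_trans.
have [l [P [lip hP]]] := bfs_paths _ _ _ Cc x0C.
pose att k x := (x \in C) && [exists u, (tau u == k) && G x u].
pose A := [seq k <- iota 0 n | [exists x, att k x]].
have AP k : k \in A -> (k < n)%N /\ exists x u, [/\ x \in C, tau u = k & G x u].
  rewrite mem_filter mem_iota /= add0n => /andP[/existsP[x /andP[xC]]].
  by move=> /existsP[u /andP[/eqP uk xu]] ->; split => //; exists x, u.
have mem_A x u : x \in C -> (tau u < n)%N -> G x u -> tau u \in A.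
  move=> xC un xu; rewrite mem_filter mem_iota /= add0n un andbT.
  apply/existsP; exists x; rewrite /att xC /=.
  by apply/existsP; exists u; rewrite eqxx.
have sA : (size A <= m)%N.
  by apply: (few_attached L C) => //; rewrite filter_uniq ?iota_uniq.
(* The parts attached to [C] occupy at most [m] of the [m.+1] slots. *)
have [s sP] : exists s : 'I_m.+1, s \notin map sl A.
  apply/existsP; apply: contraT; rewrite negb_exists => /forallP h.
  have := card_size (map sl A); have <- : #|'I_m.+1| = #|map sl A|.
    by apply: eq_card => i; rewrite !inE; move: (h i); rewrite negbK => ->.
  by rewrite card_ord size_map leqNgt ltnS sA.
pose h k := odflt x0 [pick x | att k x].
have hC k : h k \in C.
  by rewrite /h; case: pickP => [x /andP[]|].
have hatt k : k \in A -> exists u, tau u = k /\ G (h k) u.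
  rewrite mem_filter => /andP[/existsP[x xa] _]; rewrite /h; case: pickP => [y|].
    by move=> /andP[_ /existsP[u /andP[/eqP]]]; exists u.
  by move/(_ x); rewrite xa.
(* Including [x0] makes [H] nonempty even when no earlier part is attached. The list has at most
   [m.+1] entries, so [inord] will not truncate [idx]. *)
pose T := x0 :: map h A.
have TC y : y \in T -> y \in C.
  by rewrite inE => /predU1P[->//|/mapP[k _ ->]].
pose H := [set z | has (fun y => z \in P y) T]%SET.
pose idx z := find (fun y => z \in P y) T.
have idxP z : z \in H -> z \in P (nth x0 T (idx z)) /\ (idx z < m.+1)%N.
  rewrite inE => hz; split; first exact: (nth_find x0 hz).
  by move: hz; rewrite has_find => /leq_trans; apply; rewrite /= size_map.
have TidxC z : z \in H -> nth x0 T (idx z) \in T.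
  by rewrite inE has_find => hz; exact: mem_nth.
have HC z : z \in H -> z \in C.
  rewrite inE => /hasP[y /TC/hP[_ _ /fintype.subsetP sub _ _] zy]; exact: sub.
have PH y z : y \in T -> z \in P y -> z \in H.
  by move=> yT zy; rewrite inE; apply/hasP; exists y.
have x0T : x0 \in T by exact: mem_head.
have x0H : x0 \in H by apply: (PH x0) => //; case: (hP _ x0C).
have Hc : connected_in G H.
  apply: (@connected_in_root _ _ _ x0) => // z; rewrite {1}inE => /hasP[y yT zy].
  have [_ ry _ [_ yc] _] := hP _ (TC _ yT).
  apply: connect_inducedS (yc _ _ zy ry).
  by apply/fintype.subsetP => w; exact: PH.
have hH k : k \in A -> h k \in H.
  move=> kA; apply: (PH (h k)); first by rewrite inE map_f ?orbT.
  by case: (hP _ (hC k)).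
(* Unprocessed vertices outside [H] move to [n.+1], since [tau] may already take the value [n] on
   them. *)
pose tau' x := if x \in H then n else if (n <= tau x)%N then n.+1 else tau x.
pose sl' k := if k == n then s else sl k.
pose g' x : 'I_m.+1 * 'I_3 := if x \in H then (inord (idx x), inZp (l x)) else g x.
have tauH x : x \in H -> tau' x = n by rewrite /tau' => ->.
have tauD x : (tau x < n)%N -> tau' x = tau x.
  move=> xn; rewrite /tau'; case: ifP => [/HC/Cn|_]; first by rewrite leqNgt xn.
  by rewrite leqNgt xn.
have gD x : (tau x < n)%N -> g' x = g x.
  by move=> xn; rewrite /g'; case: ifP => // /HC/Cn; rewrite leqNgt xn.
have slD x : (tau x < n)%N -> sl' (tau x) = sl (tau x).
  by move=> xn; rewrite /sl' ltn_eqF.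
have slH : sl' n = s by rewrite /sl' eqxx.
have tau'S x : (tau' x < n.+1)%N -> x \in H \/ (tau x < n)%N.
  rewrite /tau'; case: ifP => [_ _|_]; first by left.
  by case: (leqP n (tau x)) => [_|xn _]; [rewrite ltnn|right].
have tau'_eq x k : (k < n)%N -> (tau' x == k) = (tau x == k).
  move=> kn; rewrite /tau'; case: ifP => [/HC/Cn nx|_].
    by rewrite !gtn_eqF // (leq_trans kn).
  by case: (leqP n (tau x)) => // nx; rewrite !gtn_eqF // ?(leq_trans kn) // ltnW // ltnW.
have tau'U x : (n < tau' x)%N -> (n <= tau x)%N /\ x \notin H.
  rewrite /tau'; case: ifP; first by rewrite ltnn.
  by move=> _; case: (leqP n (tau x)) => // xn; rewrite ltnNge ltnW.
have U'U : [set z | (n < tau' z)%N]%SET \subset U.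
  by apply/fintype.subsetP => z; rewrite !inE => /tau'U[].
have slA x u : x \in C -> (tau u < n)%N -> G x u -> s != sl (tau u).
  move=> xC un xu; apply: contra sP => /eqP->.
  by apply: map_f; exact: mem_A xu.
have injH u v : u \in H -> v \in H -> g' u = g' v -> l u = l v -> u = v.
  move=> uH vH; rewrite /g' uH vH => -[e _] luv.
  have [uP ui] := idxP _ uH; have [vP vi] := idxP _ vH.
  have [_ _ _ _] := hP _ (TC _ (TidxC _ uH)); apply => //.
  by move/(congr1 (@nat_of_ord _)): e; rewrite /= !inordK // => ->.
(* Numbers that differ by at most 2 and agree modulo 3 are equal. *)
have close u v : u \in H -> v \in H -> g' u = g' v ->
    (l u <= (l v).+2)%N -> (l v <= (l u).+2)%N -> u = v.
  move=> uH vH e luv lvu; apply: injH => //.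
  move: e; rewrite /g' uH vH => -[_ e].
  move: luv lvu e; clear; move: (l u) (l v) => a b; lia.
exists tau', sl', g'; split; last first.
  apply: proper_card; rewrite properE U'U /=.
  apply/negP => /fintype.subsetP/(_ _ x0U).
  by rewrite inE tauH // ltnn.
split.
- move=> k; rewrite ltnS leq_eqVlt => /predU1P[->|kn].
    suff -> : [set x | tau' x == n]%SET = H by [].
    apply/setP => x; rewrite inE /tau'; case: ifP => [_|_]; first by rewrite eqxx.
    by case: (leqP n (tau x)) => [_|/ltn_eqF//]; rewrite gtn_eqF.
  suff -> : [set x | tau' x == k]%SET = [set x | tau x == k]%SET.
    exact: (layer_connected _ _ _ _ L).
  by apply/setP => x; rewrite !inE tau'_eq.
(* The vertex [h (tau v)] of [H] makes the new part adjacent to the part of [v]. *)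
- have aux x y u v : x \in C -> connect (induced G U) x y -> u \in H ->
      (tau v < n)%N -> G y v ->
      sl' (tau' u) != sl' (tau' v) /\
      exists u' v', [/\ tau' u' = tau' u, tau' v' = tau' v & G u' v'].
    move=> xC xy uH vn yv; have yC := Cconn _ _ xC xy.
    rewrite tauH // slH tauD // slD //; split; first exact: slA yv.
    have [v' [e hv]] := hatt _ (mem_A _ _ yC vn yv).
    exists (h (tau v)), v'; split => //; last by rewrite tauD // e.
    by rewrite tauH // hH // (mem_A y).
  move=> x y u v /tau'U[nx xH] xy un vn xu yv uv.
  have {}xy : connect (induced G U) x y by exact: connect_inducedS xy.
  have ny : (n <= tau y)%N.
    by have := connect_induced_mem _ _ _ _ xy; rewrite !inE; exact.
  have [uH|{}un] := tau'S _ un; have [vH|{}vn] := tau'S _ vn.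
  + by rewrite !tauH ?eqxx in uv.
  + apply: (aux x y) => //; apply: (Cstep u) => //; first exact: HC.
    by rewrite edge_sym.
  + have [|||||e [v' [u' [e1 e2 e3]]]] // := aux y x v u.
    * by apply: (Cstep v) => //; [exact: HC | rewrite edge_sym].
    * by rewrite induced_connect_sym.
    by rewrite eq_sym; split => //; exists u', v'; rewrite edge_sym.
  + move: uv; rewrite !tauD // !slD // => uv.
    have [e [u' [v' [e1 e2 e3]]]] :=
      layer_attached _ _ _ _ L x y u v nx xy un vn xu yv uv.
    by split => //; exists u', v'; rewrite !tauD ?e1 ?e2.
- move=> u v un vn uv.
  have [uH|{}un] := tau'S _ un; have [vH|{}vn] := tau'S _ vn.
  + apply/eqP => -[_ e]; have vu : G v u by rewrite edge_sym.
    have := close u v uH vH e (leqW (lip _ _ (HC _ uH) (HC _ vH) uv))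
      (leqW (lip _ _ (HC _ vH) (HC _ uH) vu)).
    by move=> euv; rewrite euv edge_irr in uv.
  + rewrite (tauH u) // tauD // slH slD //; apply/eqP => -[e _].
    by have := slA u v (HC _ uH) vn uv; rewrite e eqxx.
  + rewrite (tauH v) // tauD // slH slD //; apply/eqP => -[e _].
    by have := slA v u (HC _ vH) un; rewrite edge_sym e eqxx => /(_ uv).
  + by rewrite !tauD // !slD // !gD //; exact: (layer_proper _ _ _ _ L).
(* Here [w] was unprocessed and is adjacent to [u], so it lies in [C]; hence the part of [v] is
   attached to [C] and its slot is not [s]. *)
- have mixed u v w : u \in H -> (tau v < n)%N -> (tau' u <= tau' w)%N ->
      G u w -> G v w -> sl' (tau' u) <> sl' (tau' v).
    move=> uH vn uw Guw Gvw; rewrite (tauH u) // tauD // slH slD // => e.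
    have wC : w \in C.
      apply: (Cstep u); [exact: HC| |exact: Guw].
      move: uw; rewrite tauH //; case: (ltnP (tau w) n) => // wn.
      by rewrite tauD // leqNgt wn.
    by have := slA w v wC vn; rewrite edge_sym e eqxx => /(_ Gvw).
  move=> u v w un vn uw vw Guw Gvw.
  have [uH|{}un] := tau'S _ un; have [vH|{}vn] := tau'S _ vn.
  + move=> [_ e]; have wC : w \in C.
      apply: (Cstep u); [exact: HC| |exact: Guw].
      move: uw; rewrite tauH //; case: (ltnP (tau w) n) => // wn.
      by rewrite tauD // leqNgt wn.
    have lipw z z' : z \in H -> z' \in H -> G z w -> G z' w -> (l z <= (l z').+2)%N.
      move=> zH z'H zw z'w; apply: leq_trans (lip _ _ (HC _ zH) wC zw) _.
      by rewrite ltnS; apply: lip => //; [exact: HC | rewrite edge_sym].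
    by apply: close => //; apply: lipw.
  + by move=> [e _]; case: (mixed u v w).
  + by move=> [e _]; case: (mixed v u w).
  + rewrite !tauD // !slD // !gD //; apply: (layer_back _ _ _ _ L _ _ w) => //.
    * case: (ltnP (tau w) n) uw => [wn|nw _]; first by rewrite !tauD.
      exact: ltnW (leq_trans un nw).
    * case: (ltnP (tau w) n) vw => [wn|nw _]; first by rewrite !tauD.
      exact: ltnW (leq_trans vn nw).
Qed.

Lemma back_coloring :
  exists (tau : V -> nat) (f : V -> 'I_m.+1 * ('I_m.+1 * 'I_3)),
    (forall u v, G u v -> f u != f v) /\
    forall u v w, (tau u <= tau w)%N -> (tau v <= tau w)%N -> G u w -> G v w ->
      f u = f v -> u = v.
Proof.
have : exists n tau sl g, layering n tau sl g.
  exists 0%N, (fun _ => 0%N), (fun _ => ord0), (fun _ => (ord0, ord0)).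
  by split.
move=> [n [tau [sl [g]]]].
(* Induction on the number of unprocessed vertices, starting from the stage where nothing is
   processed. *)
have [c] := ubnP #|[set x | (n <= tau x)%N]%SET|.
elim: c n tau sl g => // c IH n tau sl g; rewrite ltnS => lec L.
have [[x nx]|no] := pselect (exists x, (n <= tau x)%N).
  have [tau' [sl' [g' [L' lt']]]] := layering_step _ _ _ _ _ L nx.
  by apply: IH L'; exact: leq_trans lt' lec.
have lt x : (tau x < n)%N by rewrite ltnNge; apply/negP => nx; apply: no; exists x.
exists tau, (fun x => (sl (tau x), g x)); split.
  by move=> u v; exact: (layer_proper _ _ _ _ L).
by move=> u v w; exact: (layer_back _ _ _ _ L).
Qed.

End Layering.

(** * Arcs between equally spaced points of the circle *)

Section CircularArcs.
Context {R : realType}.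

(** Equal points would give [cos (y - x) = 1], hence a zero of the sine at [(y - x) / 2], strictly
    between 0 and [pi]. *)
Lemma circle_point_neq (x y : R) :
  0 < y - x < 2 * pi -> circle_point x <> circle_point y.
Proof.
move=> /andP[xy yx] [ec es].
have : cos (y - x) = 1.
  by rewrite cosB ec es -!expr2 cos2Dsin2.
rewrite [y - x](_ : _ = ((y - x) / 2) *+ 2); last by lra.
rewrite cos_mulr2n cos2sin2 => e.
have s0 : 0 < sin ((y - x) / 2).
  by apply: sin_gt0_pi; apply/andP; split; lra.
have : 0 < sin ((y - x) / 2) ^+ 2 by exact: exprn_gt0.
by move: e; set w := sin _ ^+ 2; lra.
Qed.

Variable n : nat.
Let delta : R := 2 * pi / n.+1%:R.

Let delta_gt0 : 0 < delta.
Proof. by rewrite divr_gt0 ?mulr_gt0 ?pi_gt0 ?ltr0n. Qed.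

Let deltaE : n.+1%:R * delta = 2 * pi.
Proof. by rewrite mulrC divfK // pnatr_eq0. Qed.

(* The arc from position [a] to position [b] among [n.+1] equally spaced
   positions; positions are read modulo [n.+1]. *)
Definition grid_arc (a b : nat) : classical_sets.set (R * R) :=
  (@circle_point R @` [set th | a%:R * delta <= th <= b%:R * delta])%classic.

Lemma grid_arc_circular a b : (a < b < a + n.+1)%N -> circular_arc (grid_arc a b).
Proof.
move=> /andP[ab ba]; exists (a%:R * delta), (b%:R * delta); split=> //.
- by rewrite ltr_pM2r // ltr_nat.
- by rewrite -deltaE -mulrDl -natrD ltr_pM2r // ltr_nat.
Qed.

Lemma grid_arc_meet p a b a' b' : (a <= p <= b)%N -> (a' <= p <= b')%N ->
  (grid_arc a b `&` grid_arc a' b' !=set0)%classic.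
Proof.
move=> h h'; exists (circle_point (p%:R * delta)).
by split; exists (p%:R * delta) => //=; rewrite !ler_pM2r // !ler_nat.
Qed.

Lemma grid_arc_meet_wrap p a b a' b' :
  (a <= p <= b)%N -> (a' <= p + n.+1 <= b')%N ->
  (grid_arc a b `&` grid_arc a' b' !=set0)%classic.
Proof.
move=> h h'; exists (circle_point (p%:R * delta)).
split; first by exists (p%:R * delta) => //=; rewrite !ler_pM2r // !ler_nat.
exists ((p + n.+1)%:R * delta); first by rewrite /= !ler_pM2r // !ler_nat.
by rewrite /circle_point natrD mulrDl deltaE (mulr_natl pi 2) cosD2pi sinD2pi.
Qed.

(** Every angle of the second arc comes strictly after every angle of the first, by less than a full
    turn. *)
Lemma grid_arc_disjoint a b a' b' : (b < a')%N -> (b' < a + n.+1)%N ->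
  ~ (grid_arc a b `&` grid_arc a' b' !=set0)%classic.
Proof.
move=> ba' b'a [_ [[x /= /andP[ax xb] <-] [y /= /andP[a'y yb'] e]]].
have := @circle_point_neq x y; rewrite e; apply => //.
have h1 : b%:R * delta < a'%:R * delta by rewrite ltr_pM2r // ltr_nat.
have : b'%:R * delta < (a + n.+1)%:R * delta by rewrite ltr_pM2r // ltr_nat.
rewrite natrD mulrDl deltaE => h2; lra.
Qed.

End CircularArcs.

(** * Intersection graphs of arcs, and two circular-arc supergraphs per colour *)

Definition meet_rel {R : realType} {V : finType}
    (A : V -> classical_sets.set (R * R)) : rel V :=
  fun x y => (x != y) && `[< (A x `&` A y !=set0)%classic >].

Lemma meet_rel_sym (R : realType) (V : finType)
  (A : V -> classical_sets.set (R * R)) : symmetric (meet_rel A).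
Proof. by move=> x y; rewrite /meet_rel eq_sym setIC. Qed.

Lemma meet_rel_irr (R : realType) (V : finType)
  (A : V -> classical_sets.set (R * R)) : irreflexive (meet_rel A).
Proof. by move=> x; rewrite /meet_rel eqxx. Qed.

Definition meet_graph {R : realType} {V : finType}
    (A : V -> classical_sets.set (R * R)) : graph V :=
  Graph (meet_rel_sym R V A) (meet_rel_irr R V A).

Lemma meet_graph_circular (R : realType) (V : finType)
    (A : V -> classical_sets.set (R * R)) :
  (forall v, circular_arc (A v)) -> circular_arc_graph R (meet_graph A).
Proof.
move=> hA; exists A; split=> // x y; split.
  by move=> /andP[-> /asboolP].
by move=> [xy h]; apply/andP; split => //; apply/asboolP.
Qed.

Section Representation.
Context {R : realType} {V : finType} (G : graph V) {T : finType}.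
Variables (sg : V -> nat) (N : nat) (f : V -> T).
Hypothesis sg_inj : injective sg.
Hypothesis sg_lt : forall v, (sg v < N)%N.
Hypothesis f_proper : forall u v, G u v -> f u != f v.
Hypothesis f_back : forall u v w, (sg u < sg w)%N -> (sg v < sg w)%N ->
  G u w -> G v w -> f u = f v -> u = v.

Let back c v := [pick u | [&& f u == c, G u v & (sg u < sg v)%N]].

(* Position [2 * N] plays the role of infinity. If [u] is the unique earlier
   neighbour of [v] of colour [c], the arc of [v] misses the vertices of colour
   [c] that come before [u] when [b = false], and those that lie between [u] and
   [v] when [b = true]. *)
Definition color_arc (c : T) (b : bool) (v : V) : classical_sets.set (R * R) :=
  if f v == c then grid_arc (2 * N) (2 * sg v) (2 * sg v).+1
  else if back c v is Some u then
    if b then grid_arc (2 * N) (2 * sg v) ((2 * sg u).+1 + (2 * N).+1)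
    else grid_arc (2 * N) (2 * sg u) (2 * N)
  else grid_arc (2 * N) (2 * sg v) (2 * N).

Lemma color_arc_circular c b v : circular_arc (color_arc c b v).
Proof.
have := sg_lt v; rewrite /color_arc; case: ifP => _ vN.
  by apply: grid_arc_circular; lia.
rewrite /back; case: pickP => [u /and3P[_ _ uv]|_]; last first.
  by apply: grid_arc_circular; lia.
by case: b; apply: grid_arc_circular; lia.
Qed.

(** All vertices outside the class share the point at infinity, so edges that avoid the class are
    kept. *)
Lemma color_arc_inf c b v : f v != c -> exists a e,
  color_arc c b v = grid_arc (2 * N) a e /\ (a <= 2 * N <= e)%N.
Proof.
have vN := sg_lt v; rewrite /color_arc => /negPf ->.
rewrite /back; case: pickP => [u /and3P[_ _ uv]|_]; [case: b|];
  do 2 eexists; split; by [reflexivity | lia].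
Qed.

(** The common point is the start [2 * sg x] of the arc of [x]. If [x] precedes [y], then [f_back]
    identifies [x] with the vertex to which the arc of [y] was extended. *)
Lemma color_arc_edge_in c b x y : f x = c -> f y != c -> G x y ->
  (color_arc c b x `&` color_arc c b y !=set0)%classic.
Proof.
move=> fx fy xy; rewrite /color_arc fx eqxx (negPf fy).
have xN := sg_lt x; have yN := sg_lt y.
have sxy : sg x <> sg y by move/sg_inj => e; rewrite -e fx eqxx in fy.
rewrite /back; case: pickP => [u /and3P[/eqP fu uy suy]|none].
  case: (ltnP (sg x) (sg y)) => lt.
    rewrite (_ : u = x); last by apply: f_back suy lt uy xy _; rewrite fu fx.
    case: b; last by apply: (@grid_arc_meet _ _ (2 * sg x)); lia.
    by apply: (@grid_arc_meet_wrap _ _ (2 * sg x)); lia.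
  by case: b; apply: (@grid_arc_meet _ _ (2 * sg x)); lia.
have lt : (sg y < sg x)%N.
  by have := none x; rewrite fx eqxx xy /=; lia.
by apply: (@grid_arc_meet _ _ (2 * sg x)); lia.
Qed.

Lemma color_arc_edge c b x y : G x y ->
  (color_arc c b x `&` color_arc c b y !=set0)%classic.
Proof.
move=> xy; have fxy := f_proper _ _ xy.
have [fx|fx] := eqVneq (f x) c.
  by apply: color_arc_edge_in => //; rewrite -fx eq_sym.
have [fy|fy] := eqVneq (f y) c.
  by rewrite setIC; apply: color_arc_edge_in => //; rewrite edge_sym.
have [a [e [-> h]]] := color_arc_inf c b x fx.
have [a' [e' [-> h']]] := color_arc_inf c b y fy.
exact: (@grid_arc_meet _ _ (2 * N)).
Qed.

Lemma color_arc_nonedge x y : (sg x < sg y)%N -> ~~ G x y ->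
  exists c b, ~ (color_arc c b x `&` color_arc c b y !=set0)%classic.
Proof.
move=> lt nxy; exists (f x).
have xN := sg_lt x; have yN := sg_lt y.
have [fy|fy] := eqVneq (f y) (f x).
  (* Doubling the positions leaves room for disjoint nondegenerate arcs within a class. *)
  by exists true; rewrite /color_arc eqxx fy eqxx; apply: grid_arc_disjoint; lia.
rewrite /color_arc eqxx (negPf fy) /back.
case: pickP => [u /and3P[/eqP fu uy suy]|none].
  have sxu : sg x <> sg u by move/sg_inj => e; rewrite -e in uy; rewrite uy in nxy.
  (* The arc of [y] must reach [u] without crossing [x]: through infinity if [u] precedes [x],
     directly otherwise. *)
  exists (sg u < sg x)%N; case: ifP => h; apply: grid_arc_disjoint; lia.
by exists true; apply: grid_arc_disjoint; lia.
Qed.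

Lemma circular_arc_representation (c0 : T) :
  exists H : 'I_#|{: T * bool}| -> graph V,
    (forall i, circular_arc_graph R (H i)) /\ is_intersection G H.
Proof.
exists (fun i => let cb := enum_val i in meet_graph (color_arc cb.1 cb.2)).
split=> [i|x y].
  by apply: meet_graph_circular => v; exact: color_arc_circular.
split=> [xy i|h].
  apply/andP; split; last by apply/asboolP; exact: color_arc_edge.
  by apply: contraTneq xy => ->; rewrite edge_irr.
have hcb c b : (color_arc c b x `&` color_arc c b y !=set0)%classic.
  by have /andP[_ /asboolP] := h (enum_rank (c, b)); rewrite enum_rankK.
apply: contraT => nxy.
have ne : x != y by have /andP[] := h (enum_rank (c0, true)).
have /orP[lt|lt] : (sg x < sg y)%N || (sg y < sg x)%N.
  by rewrite -neq_ltn; apply: contra ne => /eqP/sg_inj->.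
  by have [c [b]] := color_arc_nonedge _ _ lt nxy.
rewrite edge_sym in nxy.
by have [c [b]] := color_arc_nonedge _ _ lt nxy; rewrite setIC.
Qed.

End Representation.

Theorem theorem2 (R : realType) (t : nat) (ht : (2 <= t)%N)
  (V : finType) (G : graph V) (hG : ~ minor (complete_graph t) G) :
  exists (k : nat) (H : 'I_k -> graph V),
    [/\ (0 < k)%N,
        k%:R <= 15 / 2 * t%:R ^+ 2 :> R,
        forall i, circular_arc_graph R (H i)
      & is_intersection G H].
Proof.
case: t ht hG => [|[|m]] // _ hG.
have [tau [f [f_proper f_back]]] := back_coloring G m hG.
(* A linear order refining [tau], with ties inside a part broken by [enum_rank]. *)
pose sg v := (tau v * #|V| + enum_rank v)%N.
have sg_tau u v : (sg u < sg v)%N -> (tau u <= tau v)%N.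
  apply: contraTT; rewrite -ltnNge -leqNgt => vu.
  apply: (@leq_trans (tau v * #|V| + #|V|)%N); first by rewrite leq_add2l ltnW.
  by rewrite addnC -mulSn (leq_trans _ (leq_addr _ _)) // leq_mul2r vu orbT.
have sg_inj : injective sg.
  move=> u v e; apply/enum_rank_inj/val_inj; move: e => /(congr1 (modn^~ #|V|)).
  by rewrite /sg !modnMDl !modn_small.
have sg_lt v : (sg v < (\max_u sg u).+1)%N by rewrite ltnS leq_bigmax.
have [u v w uw vw|H [Hc HG]] := @circular_arc_representation
  R V G _ sg _ f sg_inj sg_lt f_proper _ (ord0, (ord0, ord0)).
  by apply: f_back; exact: sg_tau.
exists #|{: 'I_m.+1 * ('I_m.+1 * 'I_3) * bool}|, H; split=> //.
  by rewrite !card_prod !card_ord card_bool.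
(* With [t = m.+2], the family has [6 * (t - 1) ^ 2] members. *)
rewrite !card_prod !card_ord card_bool !natrM.
rewrite (_ : m.+2%:R = m.+1%:R + 1 :> R); last by rewrite natr1.
have : (0 : R) <= m.+1%:R by exact: ler0n.
by set x := m.+1%:R; nra.
Qed.
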